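(* There exists a rank $2$ free semigroup of rational maps $S=\langle Q,R\rangle$ such that $Q$ and $R$ do not share a common invariant probability measure on $\overline{\mathbb{C}}$. In particular, $S$ is free and, moreover, $S$ is not Koopman left amenable.
   Context: $\langle Q,R\rangle$ is the semigroup generated by $Q$ and $R$ under composition; it is free of rank $2$ if it is freely generated by $Q$ and $R$. A Borel measure $\mu$ on $\overline{\mathbb{C}}$ is invariant for $R$ if $R_*\mu=\mu$. For a semigroup $S$, $L_\infty(S)$ is the space of bounded complex functions on $S$ with supremum norm, and $(l_s\phi)(t)=\phi(st)$. A mean is a positive continuous linear functional $M$ on $L_\infty(S)$ with $M(1)=1$. The Koopman anti-representation of $S$ is $\rho(g)=K_g$, acting on the Banach space $B=\mathcal{C}(\overline{\mathbb{C}})$ of continuous functions by $K_g(\phi)=\phi\circ g$. For $(b,b^* )\in B\times B^*$ put $f_{(b,b^* )}(s)=b^*(\rho(s)(b))$; let $Y_\rho\subset L_\infty(S)$ be the closure of the linear span of all $f_{(b,b^* )}$ and $X_\rho$ the space generated by $Y_\rho$ and the constants (it is left invariant). $S$ is Koopman left amenable if there is a mean $M$ with $M(l_s\phi)=M(\phi)$ for all $s\in S$ and $\phi\in X_\rho$. *)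

(* Defs.v *)
From HB Require Import structures.
From mathcomp Require Import all_boot all_order all_algebra.
From mathcomp Require Import all_classical all_reals all_analysis.
From mathcomp Require Import complex.

Set Implicit Arguments.
Unset Strict Implicit.
Unset Printing Implicit Defensive.

Import Order.TTheory GRing.Theory Num.Theory.
Import numFieldNormedType.Exports.
Import Normc.

Local Open Scope classical_set_scope.
Local Open Scope ring_scope.

(* [R[i]] packaged as a [numClosedFieldType], so that it carries the topology
   and the normed-module structure (over itself) of every numeric field. *)
Definition cplx (R : realType) : numClosedFieldType := R[i].

Arguments cplx : simpl never.

Notation sphere R := (one_point_compactification (cplx R)).

Section sup_norm.
Variables (R : realType) (T : Type).
Local Notation C := (cplx R).
Implicit Types f g : T -> C.

Definition sup_norm f : C := (sup [set normc (f t) | t in setT])%:C%C.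

Lemma bounded_funE f :
  bounded_fun f <-> exists c : C, forall t, `|f t| <= c.
Proof.
split=> [[M [Mr Mf]]|[c fc]].
  by exists (M + 1) => t; apply: Mf => //; rewrite ltrDl.
exists `|c|; split=> [|x cx t _]; first exact: normr_real.
apply: le_trans (ltW cx); rewrite [leRHS]ger0_norm//.
exact: le_trans (normr_ge0 _) (fc t).
Qed.

Lemma sup_norm_ub f t : bounded_fun f -> `|f t| <= sup_norm f.
Proof.
move=> /bounded_funE[c fc].
have /complex_realP[k ck] : c \is Num.real.
  by apply: ger0_real; apply: le_trans (fc t).
rewrite lecR; apply: sup_upper_bound; last by exists t.
split; first by exists (normc (f t)), t.
by exists k => _ [s _ <-]; rewrite -lecR -ck; exact: fc.
Qed.

Lemma sup_norm_ge0 f : 0 <= sup_norm f.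
Proof.
rewrite lecR.
have [sf|/sup_out sf] := pselect (has_sup [set normc (f t) | t in setT]);
  last by rewrite sf.
have [[x [t _ tx]] _] := sf.
apply: le_trans (sup_upper_bound sf (ex_intro2 _ _ t I erefl)).
by case: (f t) => a b; exact: sqrtr_ge0.
Qed.

Lemma sup_norm_le f (c : C) :
  0 <= c -> (forall t, `|f t| <= c) -> sup_norm f <= c.
Proof.
move=> c0 fc; have /complex_realP[k ck] : c \is Num.real by exact: ger0_real.
rewrite ck lecR.
have [->|/set0P ne] := eqVneq [set normc (f t) | t in setT] set0.
  by rewrite sup0 -lecR -ck.
by apply: ge_sup => // _ [t _ <-]; rewrite -lecR -ck; exact: fc.
Qed.

Lemma sup_normD f g : bounded_fun f -> bounded_fun g ->
  sup_norm (f \+ g) <= sup_norm f + sup_norm g.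
Proof.
move=> bf bg; apply: sup_norm_le => [|t].
  by rewrite addr_ge0// sup_norm_ge0.
apply: le_trans (ler_normD _ _) _; apply: lerD; exact: sup_norm_ub.
Qed.

Lemma sup_norm_eq0 f : bounded_fun f -> sup_norm f = 0 -> f = cst 0.
Proof.
move=> bf f0; apply/funext => t; apply/eqP; rewrite -normr_le0 -f0.
exact: sup_norm_ub.
Qed.

Lemma sup_normZ (a : C) f : bounded_fun f ->
  sup_norm (fun t => a * f t) = `|a| * sup_norm f.
Proof.
move=> bf; have bz b (g : T -> C) : bounded_fun g ->
    sup_norm (fun t => b * g t) <= `|b| * sup_norm g.
  move=> bg; apply: sup_norm_le => [|t].
    by rewrite mulr_ge0// sup_norm_ge0.
  by rewrite normrM; apply: ler_wpM2l => //; exact: sup_norm_ub.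
apply/eqP; rewrite eq_le bz//=.
have [->|a0] := eqVneq a 0; first by rewrite normr0 mul0r sup_norm_ge0.
rewrite -ler_pdivlMl ?normr_gt0// -normfV.
rewrite -[in leLHS](_ : (fun t => a^-1 * (a * f t)) = f); last first.
  by apply/funext => t; rewrite mulKf.
apply: bz; have /bounded_funE[c fc] := bf; apply/bounded_funE.
by exists (`|a| * c) => t; rewrite normrM ler_wpM2l.
Qed.

End sup_norm.

Section Linf.
Variables (R : realType) (T : Type).
Local Notation C := (cplx R).

Definition bounded_pred : {pred T -> C} := mem [set f : T -> C | bounded_fun f].

Record Linf := MkLinf { Linf_fun :> T -> C; _ : Linf_fun \in bounded_pred }.

HB.instance Definition _ := [isSub for Linf_fun].
HB.instance Definition _ := [Choice of Linf by <:].

Lemma Linf_bounded (f : Linf) : bounded_fun f.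
Proof. by case: f => f /=; rewrite inE. Qed.

Fact bounded_submod_closed : submod_closed bounded_pred.
Proof.
split; first by rewrite inE; exact: bounded_cst.
move=> a f g; rewrite !inE => /= /bounded_funE[c fc] /bounded_funE[d gd].
apply/bounded_funE; exists (`|a| * c + d) => t; apply: le_trans (ler_normD _ _) _.
by rewrite normrM lerD// ler_wpM2l.
Qed.

HB.instance Definition _ :=
  GRing.isSubmodClosed.Build _ _ bounded_pred bounded_submod_closed.
HB.instance Definition _ := [SubChoice_isSubLmodule of Linf by <:].

Let norm (f : Linf) : C := sup_norm f.

Fact Linf_ler_normD f g : norm (f + g) <= norm f + norm g.
Proof. by apply: sup_normD; exact: Linf_bounded. Qed.

Fact Linf_normrZ (a : C) f : norm (a *: f) = `|a| * norm f.
Proof. by apply: sup_normZ; exact: Linf_bounded. Qed.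

Fact Linf_normr0_eq0 f : norm f = 0 -> f = 0.
Proof. by move=> /(sup_norm_eq0 (Linf_bounded _)) f0; exact/val_inj. Qed.

HB.instance Definition _ := Lmodule_isNormed.Build C Linf
  Linf_ler_normD Linf_normrZ Linf_normr0_eq0.

Fact Linf_cst_subproof (c : C) : cst c \in bounded_pred.
Proof. by rewrite inE; exact: bounded_cst. Qed.

Definition Linf_cst (c : C) : Linf := MkLinf (Linf_cst_subproof c).

End Linf.

Lemma sphere_bounded (R : realType) (f : sphere R -> cplx R) :
  continuous f -> bounded_fun f.
Proof.
move=> fc; have /compact_near_coveringP cov :=
  @one_point_compactification_compact (cplx R).
suff : \forall M \near +oo, forall x, [set: sphere R] x -> `|f x| <= M by [].
apply: (cov _ _ (fun M x => `|f x| <= M)) => x _.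
have fx1 : \forall y \near x, `|f x - f y| <= 1.
  by have /cvgrPdist_le := fc x; apply.
near=> y M => /=.
have -> : f y = f x - (f x - f y) by rewrite opprB addrCA subrr addr0.
apply: le_trans (ler_normB _ _) _; apply: (@le_trans _ _ (`|f x| + 1)).
  by rewrite lerD2l; near: y.
by near: M; apply: nbhs_pinfty_ge; rewrite ger0_real// addr_ge0.
Unshelve. all: by end_near. Qed.

Section Csphere.
Variable R : realType.
Local Notation C := (cplx R).

Definition continuous_pred : {pred sphere R -> C} :=
  mem [set f : sphere R -> C | continuous f].

Record Csphere :=
  MkCsphere { Csphere_fun :> sphere R -> C; _ : Csphere_fun \in continuous_pred }.

HB.instance Definition _ := [isSub for Csphere_fun].
HB.instance Definition _ := [Choice of Csphere by <:].

Lemma Csphere_continuous (f : Csphere) : continuous f.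
Proof. by case: f => f /=; rewrite inE. Qed.

Lemma Csphere_bounded (f : Csphere) : bounded_fun f.
Proof. by apply: sphere_bounded; exact: Csphere_continuous. Qed.

Fact continuous_submod_closed : submod_closed continuous_pred.
Proof.
split; first by rewrite inE /= => x; exact: (@cst_continuous (sphere R) C 0).
move=> a f g /set_mem fc /set_mem gc; apply/mem_set => x.
exact: (cvgD (cvgZl_tmp (fc x)) (gc x)).
Qed.

HB.instance Definition _ :=
  GRing.isSubmodClosed.Build _ _ continuous_pred continuous_submod_closed.
HB.instance Definition _ := [SubChoice_isSubLmodule of Csphere by <:].

Let norm (f : Csphere) : C := sup_norm f.

Fact Csphere_ler_normD f g : norm (f + g) <= norm f + norm g.
Proof. by apply: sup_normD; exact: Csphere_bounded. Qed.

Fact Csphere_normrZ (a : C) f : norm (a *: f) = `|a| * norm f.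
Proof. by apply: sup_normZ; exact: Csphere_bounded. Qed.

Fact Csphere_normr0_eq0 f : norm f = 0 -> f = 0.
Proof. by move=> /(sup_norm_eq0 (Csphere_bounded _)) f0; exact/val_inj. Qed.

HB.instance Definition _ := Lmodule_isNormed.Build C Csphere
  Csphere_ler_normD Csphere_normrZ Csphere_normr0_eq0.

End Csphere.

Section semigroups.
Variable S : semigroupType.
Local Open Scope group_scope.

Definition generated2 (a b : S) : set S :=
  smallest [set A | forall x y, A x -> A y -> A (x * y)] [set a; b].

Definition generated2_pred (a b : S) : {pred S} := mem (generated2 a b).

Record subsemigroup2 (a b : S) :=
  MkSubsemigroup2 { subsemigroup2_val :> S;
                    _ : subsemigroup2_val \in generated2_pred a b }.

HB.instance Definition _ a b := [isSub for @subsemigroup2_val a b].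
HB.instance Definition _ a b := [Choice of subsemigroup2 a b by <:].

Fact generated2_mulg_closed a b : mulg_closed (generated2_pred a b).
Proof.
move=> x y /set_mem xab /set_mem yab; apply/mem_set => A AP.
by case: (AP) => Amul _; apply: Amul; [exact: xab AP | exact: yab AP].
Qed.

HB.instance Definition _ a b :=
  SubChoice_isSubSemigroup.Build S (generated2_pred a b) (subsemigroup2 a b)
    (@generated2_mulg_closed a b).

(* The free semigroup of rank 2 is the set of nonempty words in two letters;
   [w.1] is the first letter of the word [w] and [w.2] lists the others. *)
Definition word_value (a b : S) (w : bool * seq bool) : S :=
  let letter c := if c then a else b in
  foldl (fun x c => x * letter c) (letter w.1) w.2.

Definition freely_generated (a b : S) := injective (word_value a b).

End semigroups.

Section endomaps.
Variable X : topologicalType.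

Definition endomap_comp (f g : continuousType X X) : continuousType X X :=
  f \o g.

Fact endomap_compA : associative endomap_comp.
Proof. by move=> f g h; apply/(proj2 (continuousEP _ _)). Qed.

HB.instance Definition _ := isSemigroup.Build (continuousType X X) endomap_compA.

End endomaps.

(* Rational maps of the sphere are continuous, so they are taken among the
   continuous self-maps of the sphere, which form a semigroup under composition
   and act on [Csphere] by composition. *)
Notation endomap R := (continuousType (sphere R) (sphere R)).

Section rational_maps.
Variable R : realType.
Local Notation C := (cplx R).

(* [None] is the point at infinity. [d] is the larger of the degrees of [p] and
   [q], which is the degree of [p / q] when they are coprime; the value at
   infinity is then given by the coefficients of degree [d]. *)
Definition ratmap (p q : {poly C}) (z : sphere R) : sphere R :=
  let d := (maxn (size p) (size q)).-1 in
  let frac (a b : C) := if b == 0 then None else Some (a / b) in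
  if z is Some x then frac p.[x] q.[x] else frac p`_d q`_d.

(* These are all holomorphic self-maps of the sphere, whatever their degree;
   [coprimep p q] excludes [p = q = 0], and [q = 0] is the constant map at
   infinity. *)
Definition rational_map (f : sphere R -> sphere R) :=
  exists p q : {poly C}, coprimep p q /\ f =1 ratmap p q.

Definition borel_sphere := g_sigma_algebraType (@open (sphere R)).

Definition invariant_measure (f : sphere R -> sphere R)
    (mu : set borel_sphere -> \bar R) :=
  forall A : set borel_sphere, measurable A ->
    pushforward mu (f : borel_sphere -> borel_sphere) A = mu A.

End rational_maps.

(* The semigroup [S] acts on the sphere by the continuous maps [act s]. *)
Section koopman.
Variables (R : realType) (S : semigroupType) (act : S -> endomap R).
Local Notation C := (cplx R).

Definition lin_span (V : lmodType C) (A : set V) : set V :=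
  [set v | exists (n : nat) (c : 'I_n -> C) (u : 'I_n -> V),
     (forall i, A (u i)) /\ v = \sum_(i < n) c i *: u i].

Fact left_translate_subproof (s : S) (phi : Linf R S) :
  (fun t : S => phi (s * t)%g) \in @bounded_pred R S.
Proof.
have /bounded_funE[c phic] := Linf_bounded phi.
by apply/mem_set/bounded_funE; exists c.
Qed.

Definition left_translate (s : S) (phi : Linf R S) : Linf R S :=
  MkLinf (left_translate_subproof s phi).

(* The order of [C] makes [0 <= z] mean that [z] is a nonnegative real. *)
Definition mean (M : {linear Linf R S -> C}) :=
  [/\ continuous M,
      forall phi : Linf R S, (forall s, 0 <= phi s) -> 0 <= M phi
    & M (Linf_cst S (1 : C)) = 1].

Fact koopman_subproof (g : endomap R) (b : Csphere R) :
  b \o g \in @continuous_pred R.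
Proof.
apply/mem_set => x.
by apply: continuous_comp; [exact: cts_fun | exact: Csphere_continuous].
Qed.

Definition koopman (g : endomap R) (b : Csphere R) : Csphere R :=
  MkCsphere (koopman_subproof g b).

Fact koopman_coef_subproof (b : Csphere R)
    (l : {linear Csphere R -> C}) : continuous l ->
  (fun s => l (koopman (act s) b)) \in @bounded_pred R S.
Proof.
move=> /linear_bounded_continuous /linear_boundedP /pinfty_ex_gt0[r r0 lr].
apply/mem_set/bounded_funE; exists (r * `|b|) => s.
apply: le_trans (lr _) _; apply: ler_wpM2l; first exact: ltW.
apply: sup_norm_le => [|x]; first exact: normr_ge0.
exact: (sup_norm_ub (act s x) (Csphere_bounded b)).
Qed.

Definition koopman_coef (b : Csphere R) (l : {linear Csphere R -> C})
    (lc : continuous l) : Linf R S :=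
  MkLinf (koopman_coef_subproof b lc).

Definition koopman_coefs : set (Linf R S) :=
  [set phi | exists (b : Csphere R) (l : {linear Csphere R -> C})
                    (lc : continuous l), phi = koopman_coef b lc].

Definition koopman_Y : set (Linf R S) := closure (lin_span koopman_coefs).

Definition koopman_X : set (Linf R S) :=
  lin_span (koopman_Y `|` [set Linf_cst S c | c in setT]).

Definition koopman_left_amenable :=
  exists M : {linear Linf R S -> C}, mean M /\
    forall (s : S) (phi : Linf R S), koopman_X phi ->
      M (left_translate s phi) = M phi.

End koopman.

(* Main.v *)
Require Import Defs.
From HB Require Import structures.
From mathcomp Require Import all_boot all_order all_algebra.
From mathcomp Require Import all_classical all_reals all_analysis.
From mathcomp Require Import measurable_realfun complex ring.

Import numFieldNormedType.Exports.

(** Take [Q z = z / 4] and let [R] be its conjugate [h \o Q \o h] by the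
    involution [h z = (1 - z) / (1 + z)], that is [R z = (5 z + 3) / (3 z + 5)].
    The fixed points of [Q] are [0] and infinity, those of [R] are [1] and [-1].

    Freeness is a ping-pong argument ([ping_pong]) on the segment from [0] to
    [1]: [Q] sends it strictly to the left of [1/2] and [R] strictly to the
    right, so the image of [1/2] under a word, compared with [1/2], reveals the
    first letter and whether the word is empty; the first letter is then
    cancelled by injectivity.

    The two other claims come from one inequality.  The continuous function
    [u z = 1 / (1 + |z|)], with [u = 0] at infinity, is a Lyapunov function for
    [Q]: [u (Q z) >= u z], strictly except at the two fixed points.  With
    [v = u \o h], the function [(u \o Q - u) + (v \o R - v)] equals
    [D + D \o h] for [D = u \o Q - u]; it is positive everywhere, because [h]
    moves the zeros [0] and infinity of [D] to [1] and [-1], and thus it is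
    at least some constant [c > 0] by compactness of the sphere ([drift_ge]).
    Integrating it against a probability measure invariant under both maps gives
    [0 >= c] ([no_invariant_probability_of_drift]).  Likewise, a left
    invariant mean applied to its pullback along an orbit [s |-> s p] gives
    [0 >= c] ([not_koopman_left_amenable_of_drift]): for continuous [b] the
    function [s |-> b (s p)] is a Koopman coefficient, given by evaluation at
    [p], and its left translate by [g] is the coefficient of [b \o g].

    What remains is topology: the affine maps and the inversion are continuous
    for the one-point compactification as soon as bounded sets of the field lie
    in compact sets, which for the complex numbers follows from the compactness
    of squares. *)

Set Implicit Arguments.
Unset Strict Implicit.
Unset Printing Implicit Defensive.

Import Order.TTheory GRing.Theory Num.Theory.

Local Open Scope classical_set_scope.
Local Open Scope ring_scope.

(** * Maps of the one-point compactification of a normed field *)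

Section sphere_maps.
Variable F : numFieldType.
Hypothesis disc_sub_compact : forall M : F,
  exists2 U : set F, compact U & forall z, `|z| <= M -> U z.
Local Notation sph := (one_point_compactification F).

(** Locally, [`|x| + 1] bounds the norm; compactness makes the bound uniform. *)
Lemma compact_norm_bounded (U : set F) :
  compact U -> exists2 M : F, 0 < M & forall z, U z -> `|z| < M.
Proof.
move=> /compact_near_coveringP cov.
have /cov : forall x, U x ->
    \forall y \near x & M \near (+oo : set_system F), `|y| < M.
  move=> x _; have x1 : \forall y \near x, `|x - y| < 1.
    by have /cvgrPdist_lt := @cvg_id _ (nbhs x); apply.
  near=> y M => /=.
  have -> : y = x - (x - y) by rewrite opprB addrCA subrr addr0.
  apply: le_lt_trans (ler_normB _ _) _; apply: (@lt_trans _ _ (`|x| + 1)).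
    by rewrite ltrD2l; near: y.
  by near: M; apply: nbhs_pinfty_gt; rewrite ger0_real// addr_ge0.
move=> /pinfty_ex_gt0[M M0 UM]; by exists M.
Unshelve. all: by end_near. Qed.

(** Compact sets and bounded sets are cofinal in each other, so neighborhoods of
    infinity can be handled by norm estimates. *)
Lemma nbhs_inftyP (P : set sph) :
  nbhs (None : sph) P <->
  P None /\ exists2 M : F, 0 < M & forall z : F, M < `|z| -> P (Some z).
Proof.
split=> [[U [cU clU] UP]|[PN [M M0 MP]]].
  split; first by apply: UP; right.
  have [M M0 UM] := compact_norm_bounded cU.
  exists M => // z Mz; apply: UP; left; exists z => // /UM zM.
  by have := lt_trans Mz zM; rewrite ltxx.
have [U cU MU] := disc_sub_compact M.
exists U; first by split=> //; exact: compact_closed cU.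
move=> _ [[z /= zU <-]|->//]; apply: MP.
rewrite real_ltNge ?(gtr0_real M0) ?normr_real//.
by apply/negP => /MU.
Qed.

Definition sph_affine (a b : F) (z : sph) : sph := omap (fun x => a * x + b) z.

Definition sph_inv (z : sph) : sph :=
  if z is Some x then (if x == 0 then None else Some x^-1) else Some 0.

Lemma sph_affine_continuous a b : a != 0 -> continuous (sph_affine a b).
Proof.
move=> a0 [x|].
  apply: (@continuous_comp _ _ _ (fun x : F => a * x + b) (Some : F -> sph)).
    by apply: continuousD; [exact: mulrl_continuous|exact: cst_continuous].
  exact: one_point_compactification_some_continuous.
move=> P /nbhs_inftyP[PN [M M0 MP]]; apply/nbhs_inftyP; split => //.
exists (`|a|^-1 * (M + `|b|)).
  by rewrite mulr_gt0 ?invr_gt0 ?normr_gt0// ltr_wpDr.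
move=> z; rewrite mulrC ltr_pdivrMr ?normr_gt0// => Mz /=; apply: MP.
rewrite -(ltrD2r `|b|) (lt_le_trans Mz)// mulrC -normrM.
by rewrite -[in leLHS](addrK b (a * z)) ler_normB.
Qed.

Lemma sph_inv_continuous : continuous sph_inv.
Proof.
have sc := @one_point_compactification_some_continuous F.
move=> [x|]; last first.
  move=> P /= P0; apply/nbhs_inftyP; split; first exact: nbhs_singleton P0.
  have /nbhs_ballP[e /= e0 eP] : nbhs (0 : F) (Some @^-1` P) by exact: P0.
  exists e^-1; first by rewrite invr_gt0.
  move=> z ez; have z0 : z != 0.
    by rewrite -normr_gt0; apply: lt_trans ez; rewrite invr_gt0.
  rewrite /= (negPf z0); apply: eP; rewrite /ball/= sub0r normrN normfV.
  by rewrite invf_plt ?posrE ?normr_gt0.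
have [->|x0] := eqVneq x 0.
  move=> P /=; rewrite eqxx => /nbhs_inftyP[PN [M M0 MP]].
  apply/nbhs_ballP; exists M^-1; first by rewrite /= invr_gt0.
  move=> z; rewrite /ball/= sub0r normrN => zM.
  case: eqVneq => // z0; apply: MP.
  by rewrite normfV invf_pgt ?posrE ?normr_gt0.
move=> P /= Px; rewrite (negPf x0) in Px.
have : \forall z \near x, P (Some z^-1).
  exact: (continuous_comp (inv_continuous x0) (sc _)).
have : \forall z \near x, z != 0.
  exact: (cvgr_neq0 _ (@cvg_id _ (nbhs x)) x0).
apply: filterS2 => z z0 Pz /=.
by rewrite (negPf z0).
Qed.

(** The Lyapunov function of the contraction [z / 4]. *)
Definition lyapunov (z : sph) : F := if z is Some x then (1 + `|x|)^-1 else 0.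

Lemma lyapunov_continuous : continuous lyapunov.
Proof.
move=> [x|].
  have nx : 1 + `|x| != 0 by rewrite gt_eqF// ltr_pwDl.
  have : {for x, continuous (fun x : F => (1 + `|x|)^-1)}.
    apply: (@continuous_comp _ _ _ (fun x : F => 1 + `|x|) (fun y : F => y^-1)).
      by apply: continuousD; [exact: cst_continuous|exact: norm_continuous].
    exact: inv_continuous.
  by [].
apply/(@cvgrPdist_lt _ F _ (nbhs (None : sph))) => e e0.
apply/nbhs_inftyP; split.
  by rewrite /= subrr normr0.
exists e^-1; first by rewrite invr_gt0.
move=> z ez /=; rewrite sub0r normrN ger0_norm ?invr_ge0 ?addr_ge0//.
have z1 : 0 < 1 + `|z| by rewrite ltr_pwDl.
by rewrite invf_plt ?posrE// ltr_pwDl// ltW.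
Qed.
End sphere_maps.

(** * The contraction, its conjugate and their drift *)

Section moebius.
Variable F : numFieldType.
Local Notation sph := (one_point_compactification F).
Implicit Types (x z : F) (p : sph).

Definition quarter : sph -> sph := sph_affine 4^-1 0.

(** [(1 - z) / (1 + z)], decomposed as [2 (1 + z)^-1 - 1] so that its continuity
    is inherited from affine maps and the inversion. *)
Definition cayley : sph -> sph :=
  sph_affine 2 (-1) \o (@sph_inv F \o sph_affine 1 1).

Lemma quarter_some z : quarter (Some z) = Some (z / 4).
Proof. by rewrite /quarter/= addr0 mulrC. Qed.

Lemma cayley_infty : cayley None = Some (-1).
Proof. by rewrite /cayley/= mulr0 add0r. Qed.

Lemma cayley_some z : z != -1 -> cayley (Some z) = Some ((1 - z) / (1 + z)).
Proof.
rewrite -addr_eq0 addrC => z1.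
rewrite /cayley/= mul1r addrC (negPf z1)/=; congr Some.
by field.
Qed.

Lemma cayley_pole : cayley (Some (-1)) = None.
Proof. by rewrite /cayley/= mul1r addNr eqxx. Qed.

Lemma cayleyK : involutive cayley.
Proof.
move=> [z|]; last by rewrite cayley_infty cayley_pole.
have [->|z1] := eqVneq z (-1); first by rewrite cayley_pole cayley_infty.
have z1' : 1 + z != 0 by rewrite addrC addr_eq0.
have n2 : 1 + z + (1 - z) != 0 :> F.
  by rewrite (_ : _ + _ = 2) ?pnatr_eq0//; ring.
rewrite !cayley_some//; first by congr Some; field; rewrite z1' n2.
apply: contra n2 => /eqP/(congr1 ( *%R^~ (1 + z))); rewrite divfK// => ->.
by rewrite mulN1r subrr.
Qed.

Lemma quarter_inj : injective quarter.
Proof.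
move=> [x|] [y|]//; rewrite !quarter_some => -[xy]; congr Some.
by apply: mulIf xy; rewrite invr_eq0 pnatr_eq0.
Qed.

Lemma conj_quarter_infty : cayley (quarter (cayley None)) = Some (5 / 3).
Proof.
rewrite cayley_infty quarter_some cayley_some.
  by congr Some; field.
rewrite mulN1r eqr_opp -subr_eq0 (_ : _ - _ = - 3 / 4); last by field.
by rewrite mulf_neq0 ?oppr_eq0 ?invr_eq0 ?pnatr_eq0.
Qed.

Lemma conj_quarter_some z : cayley (quarter (cayley (Some z))) =
  if 3 * z + 5 == 0 then None else Some ((5 * z + 3) / (3 * z + 5)).
Proof.
have n2 : 2 != 0 :> F by rewrite pnatr_eq0.
have [->|z1] := eqVneq z (-1).
  rewrite cayley_pole /= cayley_infty (_ : 3 * -1 + 5 = 2); last by ring.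
  by rewrite (negPf n2); congr Some; field.
have z1' : 1 + z != 0 by rewrite addrC addr_eq0.
rewrite cayley_some// quarter_some.
have e : ((1 - z) / (1 + z) / 4 == -1) = (3 * z + 5 == 0).
  rewrite -addr_eq0.
  have -> : (1 - z) / (1 + z) / 4 + 1 = (3 * z + 5) / (4 * (1 + z)) by field.
  by rewrite mulf_eq0 invr_eq0 mulf_eq0 (negPf z1') pnatr_eq0/= orbF.
have [z5|z5] := eqVneq (3 * z + 5) 0.
  have /eqP -> : (1 - z) / (1 + z) / 4 == -1 by rewrite e z5.
  exact: cayley_pole.
rewrite cayley_some ?e//; congr Some; field.
by rewrite z5 z1'.
Qed.

Lemma conj_quarter_coprime :
  coprimep (5%:P * 'X + 3%:P) (3%:P * 'X + 5%:P : {poly F}).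
Proof.
apply/Bezout_coprimepP; exists ((-3)%:P, 5%:P) => /=.
rewrite (_ : _ + _ = 16%:P); first by rewrite polyC_eqp1 pnatr_eq0.
rewrite polyCN !rmorph_nat; ring.
Qed.

Lemma lyapunov_quarter_ge p : lyapunov p <= lyapunov (quarter p).
Proof.
case: p => [z|//]; rewrite quarter_some /=.
have P x : 0 < 1 + `|x| by rewrite ltr_pwDl.
rewrite lef_pV2 ?posrE// lerD2l normrM ler_piMr// normfV ger0_norm//.
by rewrite invf_le1// ler1n.
Qed.

Lemma lyapunov_quarter_gt z :
  z != 0 -> lyapunov (Some z) < lyapunov (quarter (Some z)).
Proof.
move=> z0; rewrite quarter_some /=.
have P x : 0 < 1 + `|x| by rewrite ltr_pwDl.
rewrite ltf_pV2 ?posrE// ltrD2l normrM gtr_pMr ?normr_gt0// normfV ger0_norm//.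
by rewrite invf_lt1// ltr1n.
Qed.

(** The drift of [quarter] vanishes only at [0] and infinity, and [cayley] maps
    neither of these two points to one of them. *)
Lemma drift_gt0 p :
  0 < lyapunov (quarter p) - lyapunov p
      + (lyapunov (quarter (cayley p)) - lyapunov (cayley p)).
Proof.
have [pz|pz] : (exists2 z, z != 0 & p = Some z) \/
                (exists2 z, z != 0 & cayley p = Some z).
- case: p => [z|]; last first.
    by right; exists (-1); rewrite ?oppr_eq0 ?oner_eq0// cayley_infty.
  have [->|z0] := eqVneq z 0; last by left; exists z.
  right; exists 1; rewrite ?oner_eq0// cayley_some; last first.
    by rewrite eq_sym oppr_eq0 oner_eq0.
  by rewrite subr0 addr0 divr1.
- case: pz => z z0 ->; rewrite ltr_pwDl ?subr_gt0 ?subr_ge0//.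
    exact: lyapunov_quarter_gt.
  exact: lyapunov_quarter_ge.
- case: pz => z z0 ->; rewrite ltr_wpDl ?subr_gt0 ?subr_ge0//.
    exact: lyapunov_quarter_ge.
  exact: lyapunov_quarter_gt.
Qed.

(** Since [F] may be ordered as the complex numbers are, an inequality between
    its elements can carry information on imaginary parts: [unit_segment]
    consists of real points. *)
Definition unit_segment : set sph :=
  [set p | exists2 z, 0 <= z <= 1 & p = Some z].
Definition below_half : set sph := [set p | exists2 z, 2 * z < 1 & p = Some z].
Definition above_half : set sph := [set p | exists2 z, 1 < 2 * z & p = Some z].

Lemma quarter_interval p : unit_segment p ->
  (unit_segment `&` below_half) (quarter p).
Proof.
move=> [z /andP[z0 z1] ->]; rewrite quarter_some.
split; exists (z / 4) => //.
  by rewrite divr_ge0//= ler_pdivrMr// mul1r (le_trans z1)// ler1n.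
rewrite mulrA ltr_pdivrMr// mul1r.
rewrite (@le_lt_trans _ _ (2 * 1))//; first by rewrite ler_pM2l.
by rewrite mulr1 ltr_nat.
Qed.

Lemma conj_quarter_interval p : unit_segment p ->
  (unit_segment `&` above_half) (cayley (quarter (cayley p))).
Proof.
move=> [z /andP[z0 z1] ->].
have d0 : 0 < 3 * z + 5 by rewrite ltr_wpDl// mulr_ge0.
have n0 : 0 <= 5 * z + 3 by rewrite addr_ge0// mulr_ge0.
rewrite conj_quarter_some gt_eqF//.
split; exists ((5 * z + 3) / (3 * z + 5)) => //.
  rewrite divr_ge0 ?(ltW d0)//= ler_pdivrMr// mul1r -subr_ge0.
  rewrite (_ : _ - _ = 2 * (1 - z)); last by ring.
  by rewrite mulr_ge0// subr_ge0.
rewrite mulrA ltr_pdivlMr// mul1r -subr_gt0.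
rewrite (_ : _ - _ = 1 + 7 * z); last by ring.
by rewrite ltr_pwDl// mulr_ge0.
Qed.

End moebius.

(** * Ping-pong *)

Section freeness.
Variable X : topologicalType.
Implicit Types f g : continuousType X X.

Lemma word_valueE f g c s (x : X) :
  word_value f g (c, s) x =
    foldr (fun c y => if c then f y else g y) x (c :: s).
Proof.
rewrite /word_value /=.
have foldlE h : foldl (fun x c => (x * if c then f else g)%g) h s x =
    h (foldr (fun c y => if c then f y else g y) x s).
  elim: s h => //= d s IH h; rewrite IH /=.
  by case: d.
by rewrite foldlE; case: c.
Qed.

(** The base point [x0] lies in neither target, so it tells a nonempty word from
    the empty one; the disjointness of the targets gives the first letter. *)
Lemma ping_pong f g (E A B : set X) (x0 : X) :
  injective f -> injective g ->
  (forall x, E x -> (E `&` A) (f x)) ->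
  (forall x, E x -> (E `&` B) (g x)) ->
  A `&` B = set0 -> E x0 -> ~ A x0 -> ~ B x0 ->
  freely_generated f g.
Proof.
move=> finj ginj fE gE AB Ex0 nA nB.
pose F c y := if c then f y else g y.
have Finj c : injective (F c) by case: c => x y; [exact: finj|exact: ginj].
pose P c := if c then A else B.
have FE c x : E x -> (E `&` P c) (F c x) by case: c; [exact: fE|exact: gE].
have wE s : E (foldr F x0 s) by elim: s => //= c s /(FE c)[].
have Pn c : ~ P c x0 by case: c.
have PcI c d x : P c x -> P d x -> c = d.
  have no : ~ (A x /\ B x) by move=> ABx; have : set0 x by rewrite -AB.
  by case: c d => -[]//= ? ?; case: no.
have Finj_words s t : (forall x, foldr F x s = foldr F x t) -> s = t.
  elim: s t => [|c s IH] [|d t] //= st.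
  - by have [_] := FE d _ (wE t); rewrite -st => /Pn.
  - by have [_] := FE c _ (wE s); rewrite st => /Pn.
  have cd : c = d.
    have [_ Pc] := FE c _ (wE s); have [_ Pd] := FE d _ (wE t).
    by apply: (PcI _ _ _ Pc); rewrite st.
  by move: st; rewrite -cd => st; congr cons; apply: IH => x; apply: (Finj c).
move=> [c s] [d t] st.
have [-> ->]// : c :: s = d :: t.
by apply: Finj_words => x; rewrite -!word_valueE st.
Qed.
End freeness.

(** * The topology of the complex plane *)

Lemma cplx_disc_sub_compact (K : realType) (M : cplx K) :
  exists2 U : set (cplx K), compact U & forall z, `|z| <= M -> U z.
Proof.
have mkc : continuous (fun p : K * K => (Complex p.1 p.2 : cplx K)).
  move=> [a b]; apply/(@cvgrPdist_le (cplx K) (cplx K)) => e e0.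
  have er : e = (complex.Re e)%:C%C by rewrite RRe_real// gtr0_real.
  have e2 : 0 < complex.Re e / 2 by rewrite divr_gt0// -ltcR -er.
  have na : \forall p \near ((a, b) : K * K), `|a - p.1| <= complex.Re e / 2.
    have : p.1 @[p --> ((a, b) : K * K)] --> a by exact: cvg_fst.
    by move/(@cvgrPdist_le K K); apply.
  have nb : \forall p \near ((a, b) : K * K), `|b - p.2| <= complex.Re e / 2.
    have : p.2 @[p --> ((a, b) : K * K)] --> b by exact: cvg_snd.
    by move/(@cvgrPdist_le K K); apply.
  apply: filterS2 na nb => -[c d] /= ac bd.
  have -> : (Complex a b : cplx K) - Complex c d =
            (a - c)%:C%C + 'i%C * (b - d)%:C%C.
    by rewrite [LHS]complexE.
  apply: le_trans (ler_normD _ _) _; rewrite normrM !normc_def /=.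
  rewrite !expr0n/= !(mulr0n, addr0, add0r) expr1n sqrtr1 mul1r.
  rewrite !sqrtr_sqr er -rmorphD/= lecR.
  by rewrite (splitr (complex.Re e)) lerD.
have cptM r : compact (`[- r, r]%classic `*` `[- r, r]%classic : set (K * K)).
  by apply: compact_setX; exact: segment_compact.
exists ((fun p : K * K => (Complex p.1 p.2 : cplx K)) @`
    (`[- complex.Re M, complex.Re M]%classic `*`
     `[- complex.Re M, complex.Re M]%classic)).
  apply: continuous_compact; last exact: cptM.
  exact: continuous_subspaceT.
move=> z /= zM.
have M0 : 0 <= M := le_trans (normr_ge0 z) zM.
have Mr : M = (complex.Re M)%:C%C by rewrite RRe_real// ger0_real.
exists (complex.Re z, complex.Im z); last by case: z {zM}.
move: zM; rewrite Mr normc_def lecR => zM.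
by split => /=; rewrite in_itv/= -ler_norml; apply: le_trans zM;
  rewrite -sqrtr_sqr ler_sqrt ?addr_ge0 ?sqr_ge0// ?lerDl ?lerDr sqr_ge0.
Qed.

Lemma Re_continuous (K : realType) :
  continuous (fun z : cplx K => complex.Re z).
Proof.
move=> z; apply/(@cvgrPdist_lt K K _ (nbhs z)) => e e0.
have ec : 0 < (e%:C%C : cplx K) by rewrite ltcR.
have : \forall y \near z, `|z - y| < (e%:C%C : cplx K).
  have : y @[y --> z] --> z by exact: cvg_id.
  by move/(@cvgrPdist_lt (cplx K) (cplx K)); apply.
apply: filterS => y.
rewrite normc_def ltcR; apply: le_lt_trans.
rewrite -sqrtr_sqr ler_sqrt; last by rewrite addr_ge0// sqr_ge0.
by case: z => a b; case: y => c d /=; rewrite lerDl sqr_ge0.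
Qed.

(** * Drift excludes invariant measures *)

Section measures.
Variable K : realType.
Local Notation C := (cplx K).

(** Applied to the inverse of [w], boundedness of continuous functions on the
    sphere gives a positive lower bound. *)
Lemma sphere_min (w : sphere K -> C) : continuous w -> (forall x, 0 < w x) ->
  exists2 c : C, 0 < c & forall x, c <= w x.
Proof.
move=> wc w0.
have /bounded_funE[M wM] : bounded_fun (fun x => (w x)^-1).
  apply: sphere_bounded => x.
  apply: (@continuous_comp _ _ _ w (fun y : C => y^-1)); first exact: wc.
  by apply: inv_continuous; rewrite gt_eqF.
have M0 : 0 < M.
  by apply: lt_le_trans (wM None); rewrite normr_gt0 invr_eq0 gt_eqF.
exists M^-1; first by rewrite invr_gt0.
move=> x; rewrite invf_ple ?posrE//; apply: le_trans (wM x).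
by rewrite ger0_norm// invr_ge0 ltW.
Qed.

Lemma sphere_continuous_measurable (f : sphere K -> sphere K) :
  continuous f ->
  measurable_fun [set: borel_sphere K] (f : borel_sphere K -> borel_sphere K).
Proof.
move=> /continuousP fc.
apply: (@measurability _ _ (borel_sphere K) (borel_sphere K) setT f
  (@open (sphere K)) erefl) => _ [A oA <-].
by rewrite setTI; apply: sub_sigma_algebra; exact: fc.
Qed.

Lemma Re_sphere_measurable (u : Csphere K) :
  measurable_fun [set: borel_sphere K]
    (fun x : borel_sphere K => complex.Re (u x)).
Proof.
have /continuousP uc : continuous (fun x => complex.Re (u x)).
  move=> x; apply: continuous_comp; first exact: Csphere_continuous.
  exact: Re_continuous.
apply: (measurability _ (RGenOInfty.measurableE K)) => _ [_ [a ->] <-].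
rewrite setTI; apply: sub_sigma_algebra; apply: uc.
exact: interval_open.
Qed.

Lemma Re_sphere_integrable (mu : probability (borel_sphere K) K)
    (u : Csphere K) :
  mu.-integrable setT
    (EFin \o (fun x : borel_sphere K => complex.Re (u x))).
Proof.
apply: measurable_bounded_integrable => //.
- by rewrite (le_lt_trans (probability_le1 mu measurableT))// ltry.
- exact: Re_sphere_measurable.
have /bounded_funE[M uM] := Csphere_bounded u.
exists (complex.Re M); split=> [|x Mx y _]; first exact: num_real.
apply: le_trans (ltW Mx); rewrite -lecR RRe_real; last first.
  by rewrite ger0_real// (le_trans _ (uM y)).
apply: le_trans (uM y); rewrite normc_def lecR -sqrtr_sqr ler_sqrt.
  by rewrite lerDl sqr_ge0.
by rewrite addr_ge0// sqr_ge0.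
Qed.

Lemma Rintegral_koopman (mu : probability (borel_sphere K) K)
    (g : endomap K) (u : Csphere K) : invariant_measure g mu ->
  \int[mu]_x complex.Re (koopman g u x) = \int[mu]_x complex.Re (u x).
Proof.
move=> gmu.
have mg := sphere_continuous_measurable (@cts_fun _ _ g).
rewrite /Rintegral; congr fine.
transitivity (\int[pushforward mu (g : borel_sphere K -> borel_sphere K)]_x
  (complex.Re (u x))%:E)%E.
  symmetry.
  rewrite [LHS](integral_pushforward mg) ?preimage_setT//.
    by apply/measurable_EFinP; exact: Re_sphere_measurable.
  exact: (@Re_sphere_integrable mu (koopman g u)).
by apply: eq_measure_integral => A mA _; exact: gmu.
Qed.

Lemma no_invariant_probability_of_drift (Q R : endomap K)
    (u v : Csphere K) (c : C) :
  0 < c -> (forall x, c <= (koopman Q u - u + (koopman R v - v)) x) ->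
  ~ exists mu : probability (borel_sphere K) K,
      invariant_measure Q mu /\ invariant_measure R mu.
Proof.
move=> c0 cw [mu [Qmu Rmu]].
pose w : Csphere K := koopman Q u - u + (koopman R v - v).
have iw0 : (\int[mu]_x complex.Re (w x) = 0)%R.
  have -> : (\int[mu]_x complex.Re (w x) =
     \int[mu]_x ((complex.Re (koopman Q u x) - complex.Re (u x)) +
                (complex.Re (koopman R v x) - complex.Re (v x))))%R.
    apply: eq_Rintegral => x _.
    rewrite [LHS](_ : _ = complex.Re
      (koopman Q u x - u x + (koopman R v x - v x)))//.
    by rewrite !raddfD !raddfN.
  rewrite RintegralD//.
  - rewrite !RintegralB//; try exact: Re_sphere_integrable.
    by rewrite !Rintegral_koopman// !subrr addr0.
  - exact: (integrableB measurableT (Re_sphere_integrable mu _)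
      (Re_sphere_integrable mu _)).
  - exact: (integrableB measurableT (Re_sphere_integrable mu _)
      (Re_sphere_integrable mu _)).
have : (\int[mu]_(x in setT) complex.Re c <= \int[mu]_x complex.Re (w x))%R.
  apply: le_Rintegral => //.
  - exact: finite_measure_integrable_cst.
  - exact: Re_sphere_integrable.
  - by move=> x _; have := cw x; rewrite lecE => /andP[].
rewrite iw0 Rintegral_cst//.
have -> : fine (mu setT) = 1 by rewrite [X in fine X]probability_setT.
rewrite mulr1 => Rec.
by move: c0; rewrite ltcE /= => /andP[_]; rewrite ltNge Rec.
Qed.
End measures.

(** * Drift excludes Koopman left amenability *)

Section means.
Variable K : realType.
Local Notation C := (cplx K).

Definition eval_at (p : sphere K) (b : Csphere K) : C := b p.

Lemma eval_at_linear p : linear (eval_at p).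
Proof. by []. Qed.

HB.instance Definition _ p := GRing.isLinear.Build C (Csphere K) C *%R
  (eval_at p) (eval_at_linear p).

Lemma eval_at_continuous p : continuous (eval_at p).
Proof.
apply/linear_bounded_continuous/linear_boundedP; near=> r => b.
rewrite (@le_trans _ _ `|b|)//; first exact: sup_norm_ub (Csphere_bounded b).
rewrite ler_peMl//; near: r; exact: nbhs_pinfty_ge.
Unshelve. all: by end_near. Qed.

Lemma not_koopman_left_amenable_of_drift (S : semigroupType)
    (act : S -> endomap K) (q r : S) (u v : Csphere K) (c : C) :
  (forall s t, act (s * t)%g = endomap_comp (act s) (act t)) ->
  0 < c ->
  (forall x, c <= (koopman (act q) u - u + (koopman (act r) v - v)) x) ->
  ~ koopman_left_amenable act.
Proof.
move=> actM c0 cw [M [[Mc Mge0 M1] Minv]].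
(* the base point [None] of the orbit is arbitrary *)
pose phi b := koopman_coef act b (@eval_at_continuous None).
have phiX b : koopman_X act (phi b).
  exists 1%N, (fun _ => 1), (fun _ => phi b).
  split; last by rewrite big_ord1 scale1r.
  move=> _; left; apply: subset_closure.
  exists 1%N, (fun _ => 1), (fun _ => phi b).
  split; last by rewrite big_ord1 scale1r.
  by move=> _; exists b, (eval_at None), (@eval_at_continuous None).
have phiE s b : phi (koopman (act s) b) = left_translate s (phi b).
  by apply/val_inj/funext => t /=; rewrite /eval_at/= actM.
have Mphi s b : M (phi (koopman (act s) b)) = M (phi b) by rewrite phiE Minv.
pose psi := phi (koopman (act q) u) - phi u +
  (phi (koopman (act r) v) - phi v) - c *: Linf_cst S 1.
have : 0 <= M psi.
  apply: Mge0 => s; rewrite /psi.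
  have := cw (act s None); rewrite -subr_ge0; congr (_ <= _ - _).
  exact/esym/mulr1.
rewrite /psi linearB linearD !linearB !Mphi !subrr addr0 sub0r.
rewrite linearZ/= M1 [c *: _]mulr1.
by rewrite oppr_ge0 lt_geF.
Qed.
End means.

(** * The semigroup generated by the contraction and its conjugate *)

Section example.
Variable K : realType.
Local Notation C := (cplx K).

Lemma quarter_cts : continuous (@quarter C).
Proof.
apply: sph_affine_continuous; first exact: cplx_disc_sub_compact.
by rewrite invr_eq0 pnatr_eq0.
Qed.

Lemma cayley_cts : continuous (@cayley C).
Proof.
have pre := @cplx_disc_sub_compact K.
have a2 := @sph_affine_continuous _ pre 2 (-1) (lt0r_neq0 (ltr0n _ 2)).
have a1 := @sph_affine_continuous _ pre 1 1 (oner_neq0 _).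
have i := @sph_inv_continuous _ pre.
move=> p; apply: continuous_comp; last exact: a2.
by apply: continuous_comp; [exact: a1|exact: i].
Qed.

HB.instance Definition _ := @isContinuous.Build (sphere K) (sphere K)
  (@quarter C) quarter_cts.
HB.instance Definition _ := @isContinuous.Build (sphere K) (sphere K)
  (@cayley C) cayley_cts.

Definition quarter_map : endomap K := @quarter C.
Definition cayley_map : endomap K := @cayley C.
Definition conj_quarter_map : endomap K :=
  endomap_comp cayley_map (endomap_comp quarter_map cayley_map).

Lemma quarter_rational : rational_map quarter_map.
Proof.
exists 'X, 4%:P; split.
  apply/Bezout_coprimepP; exists (0, 1).
  by rewrite mul0r mul1r add0r polyC_eqp1 pnatr_eq0.
move=> [z|]; last first.
  by rewrite /ratmap size_polyX size_polyC pnatr_eq0/= coefC/= eqxx.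
by rewrite /= hornerX hornerC pnatr_eq0 addr0 mulrC.
Qed.

Lemma conj_quarter_rational : rational_map conj_quarter_map.
Proof.
have n0 n : n.+1%:R != 0 :> C by rewrite pnatr_eq0.
have s5 : size (5%:P * 'X + 3%:P : {poly C}) = 2.
  by rewrite size_MXaddC polyC_eq0 (negPf (n0 _)) /= size_polyC n0.
have s3 : size (3%:P * 'X + 5%:P : {poly C}) = 2.
  by rewrite size_MXaddC polyC_eq0 (negPf (n0 _)) /= size_polyC n0.
exists (5%:P * 'X + 3%:P), (3%:P * 'X + 5%:P).
split; first exact: conj_quarter_coprime.
move=> [z|].
  rewrite [LHS]conj_quarter_some /ratmap.
  by rewrite !hornerD !hornerM !hornerX !hornerC.
rewrite [LHS]conj_quarter_infty /ratmap s5 s3 !coefD !coefMX !coefC/= !addr0.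
by rewrite (negPf (n0 2%N)).
Qed.

Lemma quarter_free : freely_generated quarter_map conj_quarter_map.
Proof.
have half : (2 * 2^-1 : C) = 1 by rewrite divff// pnatr_eq0.
apply: (@ping_pong _ _ _ (@unit_segment C) (@below_half C) (@above_half C)
  (Some 2^-1)).
- exact: quarter_inj.
- move=> p q pq; apply: (can_inj (@cayleyK C)); apply: quarter_inj.
  exact: (can_inj (@cayleyK C)) pq.
- exact: quarter_interval.
- exact: conj_quarter_interval.
- apply/seteqP; split => // p [[z z1 ->] [y /[swap] -[<-] z2]].
  by have := lt_trans z1 z2; rewrite ltxx.
- by exists 2^-1 => //; rewrite invr_ge0 ler0n invf_le1 ?ler1n ?ltr0n.
- by move=> [z /[swap] -[<-]]; rewrite half ltxx.
- by move=> [z /[swap] -[<-]]; rewrite half ltxx.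
Qed.

Lemma lyapunov_cts : @lyapunov C \in @continuous_pred K.
Proof.
apply/mem_set; apply: lyapunov_continuous; exact: cplx_disc_sub_compact.
Qed.

Definition lyapunov_map : Csphere K := MkCsphere lyapunov_cts.

Lemma drift_ge : exists2 c : C, 0 < c & forall x, c <=
  (koopman quarter_map lyapunov_map - lyapunov_map +
   (koopman conj_quarter_map (koopman cayley_map lyapunov_map) -
    koopman cayley_map lyapunov_map)) x.
Proof.
apply: sphere_min; first exact: Csphere_continuous.
move=> x; have := drift_gt0 x.
(* [cayley \o conj_quarter_map = quarter \o cayley] as [cayley] is involutive *)
congr (0 < _ + (lyapunov _ - _)).
by rewrite /= cayleyK.
Qed.
End example.

Theorem proposition15 (K : realType) :
  exists Q R : endomap K,
    [/\ rational_map Q, rational_map R, freely_generated Q R,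
        ~ (exists mu : probability (borel_sphere K) K,
             invariant_measure Q mu /\ invariant_measure R mu)
      & ~ koopman_left_amenable (@subsemigroup2_val _ Q R)].
Proof.
have [c c0 cw] := drift_ge K.
exists (quarter_map K), (conj_quarter_map K); split.
- exact: quarter_rational.
- exact: conj_quarter_rational.
- exact: quarter_free.
- exact: no_invariant_probability_of_drift c0 cw.
have Qin :
    quarter_map K \in generated2_pred (quarter_map K) (conj_quarter_map K).
  by apply/mem_set => A [_]; apply; left.
have Rin :
    conj_quarter_map K \in generated2_pred (quarter_map K) (conj_quarter_map K).
  by apply/mem_set => A [_]; apply; right.
apply: (@not_koopman_left_amenable_of_drift _ _ _
  (MkSubsemigroup2 Qin) (MkSubsemigroup2 Rin) _ _ c) => //.
Qed.
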